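(* Let $\mathcal{G}$ be a class of graphs. If $\mathcal{G}$ is closed under contraction of edges, then for every $\Delta$: (i) $\omega_2'(\mathcal{G},\Delta)\le \omega(\mathcal{G})(\Delta+1)$; (ii) $\chi_{2,f}'(\mathcal{G},\Delta)\le \chi_f(\mathcal{G})(\Delta+1)$; (iii) $\chi_2'(\mathcal{G},\Delta)\le \chi(\mathcal{G})(\Delta+1)$. If $\mathcal{G}$ is closed under attachment of pendant edges, then (iv) $\omega_2'(\mathcal{G},\Delta)\ge \omega(\mathcal{G})\Delta-\binom{\omega(\mathcal{G})}{2}$ if $\Delta>\omega(\mathcal{G})$; and (v) $\chi_{2,f}'(\mathcal{G},\Delta)\ge \chi_f(G)(\Delta-|V(G)|+1)$ for every $G\in\mathcal{G}$ with $|V(G)|<\Delta$.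
   Context: Graphs are simple. $L(G)^2$ denotes the square of the line graph of $G$: vertices are edges of $G$, two adjacent if they share an endpoint or are joined by an edge of $G$. Strong clique number $\omega_2'(G)=\omega(L(G)^2)$, strong chromatic index $\chi_2'(G)=\chi(L(G)^2)$, fractional strong chromatic index $\chi_{2,f}'(G)=\chi_f(L(G)^2)$, where $\chi_f$ is the fractional chromatic number (least total weight on stable sets covering each vertex with weight at least $1$). For a class $\mathcal{G}$: $\omega(\mathcal{G})$, $\chi(\mathcal{G})$, $\chi_f(\mathcal{G})$ denote the largest clique order, chromatic number, fractional chromatic number over graphs in $\mathcal{G}$; $\omega_2'(\mathcal{G},\Delta)$, $\chi_{2,f}'(\mathcal{G},\Delta)$, $\chi_2'(\mathcal{G},\Delta)$ denote the largest strong clique number, fractional strong chromatic index, strong chromatic index over graphs in $\mathcal{G}$ of maximum degree $\Delta$.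
   Formalization: In (iv) it is additionally assumed that some graph in the class has clique number ω(G) and maximum degree at most Δ; without this (iv) fails, e.g. for trees together with all pendant extensions of a triangle having 100 leaves at one vertex, with Δ=4 (7 < 9). *)

(* Defs.v *)
From HB Require Import structures.
From mathcomp Require Import all_boot all_order all_algebra.
From mathcomp Require Import all_classical all_reals all_analysis.

Set Implicit Arguments.
Unset Strict Implicit.
Unset Printing Implicit Defensive.

Import Order.TTheory GRing.Theory Num.Theory.

Local Open Scope classical_set_scope.
Local Open Scope ring_scope.

(** * Finite simple graphs (the graph without vertices is allowed) *)

Record sgraph := SGraph {
  vertex :> finType;
  adj : rel vertex;
  adj_sym : symmetric adj;
  adj_irrefl : irreflexive adj }.

Arguments adj {s} x y : rename.

Definition isomorphic (G H : sgraph) : Prop :=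
  exists2 f : G -> H, bijective f & {mono f : x y / adj x y}.

Definition max_degree (G : sgraph) : nat :=
  (\max_(v : G) #|[set w : G | adj v w]%SET|)%N.

Definition clique (G : sgraph) (A : {set G}) : bool :=
  [forall x in A, forall y in A, (x != y) ==> adj x y].

Definition stable (G : sgraph) (A : {set G}) : bool :=
  [forall x in A, forall y in A, ~~ adj x y].

Definition clique_number (G : sgraph) : nat :=
  (\max_(A : {set G} | clique A) #|A|)%N.

Definition colorable (G : sgraph) (k : nat) : bool :=
  [exists c : {ffun G -> 'I_k}, forall x, forall y, adj x y ==> (c x != c y)].

Lemma colorable_card (G : sgraph) : exists k, colorable G k.
Proof.
exists #|G|; apply/existsP; exists [ffun x => enum_rank x].
apply/forallP => x; apply/forallP => y; apply/implyP => xy; rewrite !ffunE.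
by apply: contraTneq xy => /enum_rank_inj ->; rewrite adj_irrefl.
Qed.

Definition chromatic_number (G : sgraph) : nat := ex_minn (colorable_card G).

Definition fractional_coloring (R : realType) (G : sgraph)
    (w : {set G} -> R) : Prop :=
  (forall S, stable S -> 0 <= w S) /\
  (forall v : G, 1 <= \sum_(S : {set G} | stable S && (v \in S)) w S).

Definition fractional_chromatic_number (R : realType) (G : sgraph) : R :=
  inf [set \sum_(S : {set G} | stable S) w S
      | w in [set w : {set G} -> R | fractional_coloring w]].

(** [inf] takes a junk value on sets that are empty or not bounded below;
    this never happens here. *)
Lemma fractional_chromatic_number_has_inf (R : realType) (G : sgraph) :
  has_inf [set \sum_(S : {set G} | stable S) w S
          | w in [set w : {set G} -> R | fractional_coloring w]].
Proof.
split.
  eexists; exists (fun=> 1) => //; split=> // v.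
  have sv : stable [set v]%SET.
    apply/forall_inP => x /set1P ->; apply/forall_inP => y /set1P ->.
    by rewrite adj_irrefl.
  rewrite (bigD1 [set v]%SET) /=; last by rewrite sv set11.
  by rewrite lerDl sumr_ge0.
by exists 0 => _ [w [w0 _] <-]; exact: sumr_ge0.
Qed.

(** * The square of the line graph *)

Definition edges (G : sgraph) : {set {set G}} :=
  [set e : {set G} | [exists x, exists y, adj x y && (e == [set x; y])]]%SET.

Definition edge_type (G : sgraph) : finType := {e : {set G} | e \in edges G}.

Definition line_adj (G : sgraph) : rel (edge_type G) :=
  fun e f => (e != f) && (val e :&: val f != finset.set0)%SET.

Lemma line_adj_sym (G : sgraph) : symmetric (@line_adj G).
Proof. by move=> e f; rewrite /line_adj eq_sym finset.setIC. Qed.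

Lemma line_adj_irrefl (G : sgraph) : irreflexive (@line_adj G).
Proof. by move=> e; rewrite /line_adj eqxx. Qed.

Definition line_graph (G : sgraph) : sgraph :=
  SGraph (@line_adj_sym G) (@line_adj_irrefl G).

Definition square_adj (G : sgraph) : rel G :=
  fun x y => (x != y) && (adj x y || [exists z, adj x z && adj z y]).

Lemma square_adj_sym (G : sgraph) : symmetric (@square_adj G).
Proof.
move=> x y; rewrite /square_adj eq_sym adj_sym; congr (_ && (_ || _)).
by apply: eq_existsb => z; rewrite andbC (adj_sym z) (adj_sym x).
Qed.

Lemma square_adj_irrefl (G : sgraph) : irreflexive (@square_adj G).
Proof. by move=> x; rewrite /square_adj eqxx. Qed.

Definition square (G : sgraph) : sgraph :=
  SGraph (@square_adj_sym G) (@square_adj_irrefl G).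

Definition line_square (G : sgraph) : sgraph := square (line_graph G).

Lemma line_square_adjE (G : sgraph) (e f : line_square G) :
  adj e f = (e != f) &&
    ((val e :&: val f != finset.set0)%SET
     || [exists x in val e, exists y in val f, adj x y]).
Proof.
rewrite -[LHS]/(square_adj (e : line_graph G) f) /square_adj.
rewrite -[@adj (line_graph G)]/(@line_adj G); case: (eqVneq e f) => //= nef.
rewrite {1}/line_adj nef /=.
have [//|/negPn/eqP ef0 /=] := boolP (_ != finset.set0).
have disj x : x \in val e -> x \in val f -> False.
  by move=> xe xf; have := finset.in_set0 x; rewrite -ef0 finset.in_setI xe xf.
apply/existsP/exists_inP.
- case=> g /andP[/andP[_ /set0Pn[x]] /[!inE]/andP[xe xg]].
  move=> /andP[_ /set0Pn[y]] /[!inE]/andP[yg yf].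
  exists x => //; apply/exists_inP; exists y => //.
  have nxy : x != y.
    by apply/eqP => xy; apply: (disj x) => //; rewrite xy.
  move: (valP g); rewrite inE => /existsP[a /existsP[b /andP[ab /eqP gab]]].
  move: xg yg nxy; rewrite gab !inE.
  move=> /orP[]/eqP -> /orP[]/eqP ->; rewrite ?eqxx // => _.
  by rewrite adj_sym.
- case=> x xe /exists_inP[y yf xy].
  have gE : [set x; y]%SET \in edges G.
    by rewrite inE; apply/existsP; exists x; apply/existsP; exists y; rewrite xy /=.
  exists (exist (fun g => g \in edges G) _ gE); apply/andP; split; apply/andP; split.
  + by apply/eqP => eg; apply: (disj y) => //; rewrite eg /= !inE eqxx orbT.
  + by apply/set0Pn; exists x; rewrite /= !inE xe eqxx.
  + by apply/eqP => gf; apply: (disj x) => //; rewrite -gf /= !inE eqxx.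
  + by apply/set0Pn; exists y; rewrite /= !inE yf eqxx orbT.
Qed.

Definition strong_clique_number (G : sgraph) : nat :=
  clique_number (line_square G).

Definition strong_chromatic_index (G : sgraph) : nat :=
  chromatic_number (line_square G).

Definition fractional_strong_chromatic_index (R : realType) (G : sgraph) : R :=
  fractional_chromatic_number R (line_square G).

(** * Edge contraction and pendant edges *)

(** [contract u v] is meant for [adj u v]: [v] is removed and [u] plays the role
    of the merged vertex; loops and parallel edges disappear. *)
Definition contract_adj (G : sgraph) (u v : G) : rel {x : G | x != v} :=
  fun x y => (x != y) &&
    [|| adj (val x) (val y),
        (val x == u) && adj v (val y)
      | (val y == u) && adj (val x) v].

Lemma contract_adj_sym (G : sgraph) (u v : G) : symmetric (contract_adj u (v := v)).
Proof.
move=> x y; rewrite /contract_adj eq_sym (adj_sym (val x) (val y)).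
by rewrite (adj_sym v (val y)) (adj_sym v (val x)); congr (_ && (_ || _)); rewrite orbC.
Qed.

Lemma contract_adj_irrefl (G : sgraph) (u v : G) :
  irreflexive (contract_adj u (v := v)).
Proof. by move=> x; rewrite /contract_adj eqxx. Qed.

Definition contract (G : sgraph) (u v : G) : sgraph :=
  SGraph (@contract_adj_sym G u v) (@contract_adj_irrefl G u v).

(** The new vertex is [None]; its only neighbour is [v]. *)
Definition pendant_adj (G : sgraph) (v : G) : rel (option G) :=
  fun x y => match x, y with
  | Some a, Some b => adj a b
  | Some a, None => a == v
  | None, Some b => b == v
  | None, None => false
  end.

Lemma pendant_adj_sym (G : sgraph) (v : G) : symmetric (pendant_adj v).
Proof. by case=> [a|] [b|] //=; exact: adj_sym. Qed.

Lemma pendant_adj_irrefl (G : sgraph) (v : G) : irreflexive (pendant_adj v).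
Proof. by case=> [a|] //=; exact: adj_irrefl. Qed.

Definition attach_pendant (G : sgraph) (v : G) : sgraph :=
  SGraph (@pendant_adj_sym G v) (@pendant_adj_irrefl G v).

(** * Classes of graphs *)

Record graph_class := GraphClass {
  in_class :> sgraph -> Prop;
  in_class_iso : forall G H : sgraph, isomorphic G H -> in_class G -> in_class H }.

Definition contraction_closed (C : graph_class) : Prop :=
  forall (G : sgraph) (u v : G), C G -> adj u v -> C (contract u v).

Definition pendant_closed (C : graph_class) : Prop :=
  forall (G : sgraph) (v : G), C G -> C (attach_pendant v).

(** Supremum in [0, +oo] of a nonnegative graph parameter over the graphs
    satisfying [P]; it is 0 if there are none. *)
Definition class_sup (R : realType) (P : sgraph -> Prop) (f : sgraph -> R) : \bar R :=
  maxe 0%E (ereal_sup [set x | exists2 G, P G & x = (f G)%:E]).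

Section ClassParameters.
Variables (R : realType) (C : graph_class).

Definition class_omega : \bar R :=
  class_sup C (fun G => (clique_number G)%:R).

(** Closure under pendant edges alone does not make [class_omega] visible among
    members of maximum degree [D], and then the lower bound on
    [class_strong_omega] in terms of [class_omega] fails. For instance, let [C]
    consist of all trees and of all graphs obtained by repeatedly attaching
    pendant edges to the graph made of a triangle and 100 leaves at one of its
    vertices. Then [class_omega] is 3, but the members of maximum degree 4 are
    trees, whose strong clique number is at most 7, and 7 < 3 * 4 - 'C(3, 2). *)
Definition omega_attained (D : nat) : Prop :=
  exists G : sgraph, [/\ C G, class_omega = (clique_number G)%:R%:E
                       & (max_degree G <= D)%N].

Definition class_chi : \bar R :=
  class_sup C (fun G => (chromatic_number G)%:R).

Definition class_chif : \bar R :=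
  class_sup C (fractional_chromatic_number R).

Definition of_max_degree (D : nat) (G : sgraph) : Prop :=
  C G /\ max_degree G = D.

Definition class_strong_omega (D : nat) : \bar R :=
  class_sup (of_max_degree D) (fun G => (strong_clique_number G)%:R).

Definition class_strong_chi (D : nat) : \bar R :=
  class_sup (of_max_degree D) (fun G => (strong_chromatic_index G)%:R).

Definition class_strong_chif (D : nat) : \bar R :=
  class_sup (of_max_degree D) (fractional_strong_chromatic_index R).

End ClassParameters.

(* Main.v *)
(** By Vizing's theorem the edges of a graph of maximum degree [D] split into [D + 1]
    matchings. Contracting a matching [M] of [G] gives a graph of the class in which the
    edges of [M] are distinct vertices, adjacent as soon as they are adjacent in [L(G)^2].
    Since clique number, chromatic number and fractional chromatic number are subadditive
    over a vertex partition, this gives the upper bounds.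

    For the lower bounds, pendant edges are attached to [G] until a maximum clique,
    respectively every vertex, has degree [D] throughout. The edges meeting the clique
    form a clique of [L(G)^2]; the pendant edges induce there a graph containing the
    blow-up of [G] by cliques of order at least [D - |V(G)| + 1].

    Vizing's theorem is proved by extending a partial coloring to an uncolored edge [xy].
    Among the vertices reachable from [y] along fans at [x], either one misses a color
    missing at [x], or two miss the same color [b]. If [x] misses [a], then one of these
    two is not on the [a]/[b]-Kempe chain of [x], and swapping colors on its chain allows
    the fan to be rotated. *)

Require Import Defs.
From HB Require Import structures.
From mathcomp Require Import all_boot all_order all_algebra.
From mathcomp Require Import perm.
From mathcomp Require Import all_classical all_reals all_analysis.

Set Implicit Arguments.
Unset Strict Implicit.
Unset Printing Implicit Defensive.

Import Order.TTheory GRing.Theory Num.Theory.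

Local Open Scope ring_scope.

(** * Edges as two-element vertex sets *)

Lemma edgeP (G : sgraph) (e : edge_type G) :
  exists x y, [/\ adj x y, x != y & val e = [set x; y]%SET].
Proof.
have := valP e; rewrite inE => /existsP[x /existsP[y /andP[xy /eqP eE]]].
by exists x, y; split=> //; apply: contraTneq xy => ->; rewrite adj_irrefl.
Qed.

Lemma edgesP (G : sgraph) (x y : G) : adj x y -> [set x; y]%SET \in edges G.
Proof.
by move=> xy; rewrite inE; apply/existsP; exists x; apply/existsP; exists y; rewrite xy /=.
Qed.

Definition edge_of (G : sgraph) (x y : G) (xy : adj x y) : edge_type G :=
  exist (fun e => e \in edges G) _ (edgesP xy).

Lemma card_edge (G : sgraph) (e : edge_type G) : #|val e| = 2%N.
Proof. by have [x [y [_ xy ->]]] := edgeP e; rewrite cards2 xy. Qed.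

Lemma degree_le (G : sgraph) (v : G) : (#|[set w | adj v w]%SET| <= max_degree G)%N.
Proof. exact: (@leq_bigmax _ (fun v : G => #|[set w | adj v w]%SET|)). Qed.

(** * Vizing's theorem *)

(** Meant for [sub_path]: a step may then use that its ends lie on the path, as a fan survives
    recoloring only along its own vertices. *)
Lemma path_with_mem (T : eqType) (e : rel T) (x : T) (p : seq T) : path e x p ->
  path [rel u v | [&& u \in x :: p, e u v & v \in p]] x p.
Proof.
move=> /(pathP x) pp; apply/(pathP x) => i ip /=.
by rewrite pp // !mem_nth //= ltnW.
Qed.

(** * Endpoints in graphs of maximum degree two *)

Section ThreeEndpoints.
Variables (T : finType) (e : rel T).
Hypothesis e_sym : symmetric e.
Hypothesis deg2 : forall u v1 v2 v3, e u v1 -> e u v2 -> e u v3 ->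
  [|| v1 == v2, v1 == v3 | v2 == v3].

Definition endpoint t := forall v1 v2, e t v1 -> e t v2 -> v1 = v2.

(** A path entering [u] from [w] without turning back has at most one continuation. So the two paths
    run together until one stops, at an endpoint, where the other must stop too. *)
Lemma endpoint_unique (w u : T) (p q : seq T) : e w u ->
  path e u p -> path e u q -> uniq [:: w, u & p] -> uniq [:: w, u & q] ->
  {in [:: last u p; last u q], forall t, endpoint t} ->
  last u p = last u q.
Proof.
elim: p w u q => [|v p IH] w u [|v' q] //= wu.
- move=> _ /andP[uv' _] _ /andP[/[!inE]/norP[_ /norP[/eqP nwv' _]] _] end1.
  by case: nwv'; apply: (end1 u); rewrite ?inE ?eqxx ?orbT // e_sym.
- move=> /andP[uv _] _ /andP[/[!inE]/norP[_ /norP[/eqP nwv _]] _] _ end1.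
  by case: nwv; apply: (end1 u); rewrite ?inE ?eqxx ?orbT // e_sym.
- move=> /andP[uv pp] /andP[uv' pq] /andP[/[!inE]/norP[_ /norP[nwv _]] up].
  move=> /andP[/norP[_ /norP[nwv' _]] uq] end1.
  have vv' : v = v'.
    have := @deg2 u w v v'; rewrite e_sym wu uv uv' (negPf nwv) (negPf nwv') /=.
    by move=> /(_ isT isT isT)/eqP.
  by rewrite -{}vv' in pq uq end1 *; apply: (IH u).
Qed.

(** The first step out of the endpoint [x] is forced; after it, [endpoint_unique] applies. *)
Lemma three_endpoints (x y z : T) :
  {in [:: x; y; z], forall t, endpoint t} ->
  x != y -> x != z -> connect e x y -> connect e x z -> y = z.
Proof.
move=> end1 xy xz /connectP[p0 /shortenP[p pp up _] yE].
move=> /connectP[q0 /shortenP[q pq uq _] zE].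
case: p => [|v p] in pp up yE *; first by rewrite yE eqxx in xy.
case: q => [|v' q] in pq uq zE *; first by rewrite zE eqxx in xz.
move: pp pq => /= /andP[xv pp] /andP[xv' pq].
have vv' : v = v' by apply: (end1 x); rewrite ?inE ?eqxx.
rewrite -{}vv' in pq uq zE *; rewrite yE zE.
apply: (endpoint_unique xv) => // t.
by rewrite -[last v p]yE -[last v q]zE => tyz; apply: end1; rewrite inE tyz orbT.
Qed.

End ThreeEndpoints.

(** * Partial edge colorings, fans and Kempe chains *)

Section EdgeColoring.
Variables (T K : finType) (e : rel T).
Hypotheses (e_sym : symmetric e) (e_irr : irreflexive e).
Hypothesis deg_lt : forall u, (#|[set v | e u v]%SET| < #|K|)%N.

Implicit Types (c : T -> T -> option K) (x y u v : T) (a b : K).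

(* A partial proper coloring: [None] marks the uncolored edges and the non-edges. *)
Record edge_coloring c : Prop := EdgeColoring {
  ec_sym : forall u v, c u v = c v u;
  ec_edge : forall u v, c u v -> e u v;
  ec_inj : forall u v w a, c u v = Some a -> c u w = Some a -> v = w }.

Definition missing c u : {set K} := [set a | [forall v, c u v != Some a]]%SET.

Lemma missingP c u a : reflect (forall v, c u v <> Some a) (a \in missing c u).
Proof. by rewrite inE; apply: (iffP forallP) => H v; apply/eqP/H. Qed.

(** If every color occurred at [u], sending each color to the neighbour it leads to would inject [K]
    into the neighbours of [u]. *)
Lemma exists_missing c u : edge_coloring c -> exists a, a \in missing c u.
Proof.
move=> cP; apply/existsP; rewrite -[X in is_true X]negbK negb_exists.
apply/negP => /forallP nm.
have hv a : exists v, c u v == Some a.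
  by have := nm a; rewrite inE negb_forall => /existsP[v]; rewrite negbK; exists v.
pose g a := xchoose (hv a).
have gE a : c u (g a) = Some a by apply/eqP/(xchooseP (hv a)).
have g_inj : injective g.
  by move=> a b gab; apply: Some_inj; rewrite -(gE a) -(gE b) gab.
have := deg_lt u; rewrite -(card_codom g_inj) ltnNge => /negP; apply.
apply/subset_leq_card/fintype.subsetP => _ /codomP[a ->].
by rewrite inE; apply: (ec_edge cP); rewrite gE.
Qed.

(** Both orders of the pair change, which keeps the coloring symmetric; [None] erases a color. *)
Definition recolor c x y (o : option K) u v :=
  if (u == x) && (v == y) || (u == y) && (v == x) then o else c u v.

Lemma recolor_coloring c x y o : edge_coloring c -> e x y ->
  (forall a, o = Some a -> a \in missing c x /\ a \in missing c y) ->
  edge_coloring (recolor c x y o).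
Proof.
move=> cP xy oP; have nxy : x != y by apply: contraTneq xy => ->; rewrite e_irr.
split=> [u v|u v|u v w a]; rewrite /recolor.
- by rewrite orbC ![(v == _) && _]andbC (ec_sym cP).
- by case: ifP => [/orP[]/andP[/eqP-> /eqP->] _|_ /(ec_edge cP)//]; rewrite ?xy // e_sym.
- case: ifP => [uv|_]; case: ifP => [uw|_] //.
  + move=> _ _; move: uv uw.
    case: (eqVneq u x) => [->|_] /=.
      by rewrite (negPf nxy) /= !orbF => /eqP -> /eqP.
    by move=> /andP[_ /eqP ->] /andP[_ /eqP].
  + move=> /oP[/missingP mx /missingP my].
    by case/orP: uv => /andP[/eqP -> _]; [move=> /mx|move=> /my].
  + move=> + /oP[/missingP mx /missingP my].
    by case/orP: uw => /andP[/eqP -> _]; [move=> /mx|move=> /my].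
  + exact: (ec_inj cP).
Qed.

(* A path for [fan c x] is a Vizing fan at [x]. *)
Definition fan c x y z := [exists a, (c x z == Some a) && (a \in missing c y)].

Lemma fanP c x y z :
  reflect (exists2 a, c x z = Some a & a \in missing c y) (fan c x y z).
Proof.
by apply: (iffP existsP) => [[a /andP[/eqP]]|[a /eqP]]; exists a => //; apply/andP.
Qed.

Definition extends c c' := forall u v, c u v -> c' u v.

(** Induction along the fan: the color [b] of [xz] is missing at [y], so it can move to [xy]; then
    [xz] is uncolored and the rest of the fan starts at [z]. At the end of the fan the color [a]
    fits. *)
Lemma fan_rotate c x y p a : edge_coloring c -> e x y -> c x y = None ->
  path (fan c x) y p -> uniq (y :: p) ->
  a \in missing c x -> a \in missing c (last y p) ->
  exists c', [/\ edge_coloring c', extends c c' & c' x y].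
Proof.
elim: p c y => [|z p IH] c y cP xy cxy.
  move=> _ _ ax ay; exists (recolor c x y (Some a)); split.
  - by apply: recolor_coloring => // _ [<-].
  - by move=> u v; rewrite /recolor; case: ifP.
  - by rewrite /recolor !eqxx.
move=> /= /andP[/fanP[b xz yb] pp] /and3P[+ zp up] ax alast.
rewrite in_cons => /norP[yz yp].
have nex u v : e u v -> (u == v) = false.
  by apply: contraTF => /eqP ->; rewrite e_irr.
have exz : e x z by apply: (ec_edge cP); rewrite xz.
pose c1 := recolor c x z None.
have c1P : edge_coloring c1 by apply: recolor_coloring.
have m1 u d : d \in missing c u -> d \in missing c1 u.
  by move=> /missingP du; apply/missingP => v; rewrite /c1 /recolor; case: ifP.
have bx : b \in missing c1 x.
  apply/missingP => v; rewrite /c1 /recolor eqxx /= (nex _ _ exz) /= orbF.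
  by case: eqP => // nvz xv; apply: nvz; apply: (ec_inj cP xv xz).
pose c2 := recolor c1 x y (Some b).
have c2P : edge_coloring c2.
  by apply: recolor_coloring => // d [<-]; split=> //; apply: m1.
have xnxy t : t != y -> t != z -> c2 x t = c x t.
  move=> ty tz; rewrite /c2 /c1 /recolor (negPf ty) (negPf tz) /=.
  by rewrite (nex _ _ xy) (nex _ _ exz) !andbF.
(* A missing color can be lost only at [y], or at [x] if it is [b]. *)
have m2 u d : u != y -> (u != x) || (d != b) -> d \in missing c u -> d \in missing c2 u.
  move=> uy uxd /m1/missingP du; apply/missingP => v.
  rewrite /c2 /recolor (negPf uy) /= orbF; case: ifP => [/andP[ux _]|_]; last exact: du.
  by move: uxd; rewrite ux /= => db [bd]; rewrite bd eqxx in db.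
have ab : a != b.
  by apply/eqP => ab; have /missingP/(_ z) := ax; rewrite ab xz.
have ny t : t \in p -> (t != y) && (t != z).
  by move=> tp; rewrite (memPn yp) // (memPn zp).
have := IH c2 z c2P exz; case.
- by rewrite /c2 /c1 /recolor !eqxx /= [z == y]eq_sym (negPf yz) /= (nex _ _ xy).
- have := path_with_mem pp; apply: sub_path => u v /and3P[uzp /fanP[d xv du] vp].
  have [vy vz] := andP (ny v vp); apply/fanP; exists d; first by rewrite xnxy.
  have uy : u != y.
    by move: uzp; rewrite inE => /orP[/eqP->|/ny/andP[]//]; rewrite eq_sym.
  (* A later fan edge cannot carry [b], the color of [xz], because [c] is proper. *)
  apply: m2 => //; apply/orP; right; apply: contraNneq vz => db.
  by rewrite db in xv; rewrite (ec_inj cP xv xz).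
- by rewrite /= zp.
- apply/missingP => v; rewrite /c2 /recolor eqxx /= (nex _ _ xy) orbF.
  case: ifP => _; first by case=> ba; rewrite ba eqxx in ab.
  exact/missingP/m1.
- apply: m2 => //; last by rewrite ab orbT.
  have : last z p \in z :: p by exact: mem_last.
  by rewrite inE => /orP[/eqP->|/ny/andP[]//]; rewrite eq_sym.
- move=> c' [c'P ext c'xz]; exists c'; split=> //.
  + move=> u v uv; case: (boolP (c2 u v)) => [/ext //|].
    rewrite /c2 /c1 /recolor; case: ifP => // _; case: ifP => [|_]; last by rewrite uv.
    by case/orP=> /andP[/eqP -> /eqP ->] _ //; rewrite (ec_sym c'P).
  + by apply: ext; rewrite /c2 /recolor !eqxx.
Qed.

(* The components of this relation are the [a]/[b]-Kempe chains. *)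
Definition bicolored c a b u v := (c u v == Some a) || (c u v == Some b).

Lemma bicolored_sym c a b : edge_coloring c -> symmetric (bicolored c a b).
Proof. by move=> cP u v; rewrite /bicolored (ec_sym cP). Qed.

Lemma bicolored_deg2 c a b u v1 v2 v3 : edge_coloring c ->
  bicolored c a b u v1 -> bicolored c a b u v2 -> bicolored c a b u v3 ->
  [|| v1 == v2, v1 == v3 | v2 == v3].
Proof.
move=> cP /orP[]/eqP h1 /orP[]/eqP h2 /orP[]/eqP h3;
  by rewrite ?(ec_inj cP h1 h2) ?(ec_inj cP h1 h3) ?(ec_inj cP h2 h3) eqxx ?orbT.
Qed.

Lemma bicolored_endpoint c a b u : edge_coloring c ->
  (a \in missing c u) || (b \in missing c u) -> endpoint (bicolored c a b) u.
Proof.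
by move=> cP /orP[]/missingP m v1 v2 /orP[]/eqP h1 /orP[]/eqP h2;
  solve [exact: (ec_inj cP h1 h2) | by case: (m v1) | by case: (m v2)].
Qed.

(** Testing [u] alone is enough when [A] is a union of chains: an edge colored [a] or [b] then has
    both ends in [A] or neither, and the transposition fixes all other colors. *)
Definition kempe_swap c a b (A : {set T}) u v :=
  if u \in A then omap (tperm a b) (c u v) else c u v.

Section KempeSwap.
Variables (c : T -> T -> option K) (a b : K) (A : {set T}).
Hypothesis cP : edge_coloring c.
Hypothesis A_closed : forall u v, bicolored c a b u v -> (u \in A) = (v \in A).

Lemma kempe_swap_coloring : edge_coloring (kempe_swap c a b A).
Proof.
split=> [u v|u v|u v w d]; rewrite /kempe_swap.
- rewrite (ec_sym cP v u); have := @A_closed u v; rewrite /bicolored.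
  case: (c u v) => [d|] /=; last by case: ifP; case: ifP.
  have [->|/negPf da] := eqVneq d a; first by rewrite eqxx => ->.
  have [->|/negPf db] := eqVneq d b; first by rewrite eqxx orbT => ->.
  by rewrite tpermD 1?eq_sym ?da ?db // => _; case: ifP; case: ifP.
- move=> h; apply: (ec_edge cP); move: h.
  by case: ifP => // _; case: (c u v).
- case: ifP => _; last exact: (ec_inj cP).
  case E: (c u v) => [d1|] //= -[<-]; case F: (c u w) => [d2|] //= -[/perm_inj dd].
  by rewrite dd in F; apply: (ec_inj cP E F).
Qed.

Lemma kempe_swap_out u v : u \notin A -> kempe_swap c a b A u v = c u v.
Proof. by rewrite /kempe_swap => /negPf ->. Qed.

Lemma missing_kempe_swap_out u : u \notin A ->
  missing (kempe_swap c a b A) u = missing c u.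
Proof.
by move=> uA; apply/setP => d; rewrite !inE; apply: eq_forallb => v;
  rewrite kempe_swap_out.
Qed.

Lemma missing_kempe_swap_in u d : u \in A ->
  (tperm a b d \in missing (kempe_swap c a b A) u) = (d \in missing c u).
Proof.
move=> uA; rewrite !inE; apply: eq_forallb => v; rewrite /kempe_swap uA.
case: (c u v) => //= d'; congr (~~ _); apply/eqP/eqP => [[/perm_inj ->//]|[->//]].
Qed.

End KempeSwap.

(* Swapping [a] and [b] on the chain of [z] frees [a] at [z] but may break the
   fan: it is cut at its first vertex that lies on the chain and misses [b]. *)
Lemma extend_kempe c x y z p a b : edge_coloring c -> e x y -> c x y = None ->
  path (fan c x) y p -> uniq (y :: p) -> z = last y p ->
  a \in missing c x -> b \in missing c z -> ~~ connect (bicolored c a b) x z ->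
  exists c', [/\ edge_coloring c', extends c c' & c' x y].
Proof.
move=> cP xy cxy pp up zE ax bz nxz.
pose A := [set u | connect (bicolored c a b) z u]%SET.
have sconn : connect_sym (bicolored c a b).
  by apply: sym_connect_sym; apply: bicolored_sym.
have A_closed u v : bicolored c a b u v -> (u \in A) = (v \in A).
  by move=> uv; rewrite !inE; apply: same_connect_r => //; exact: connect1.
(* As [x] is off the chain of [z], the colors of the edges at [x] do not change. *)
have xA : x \notin A by rewrite inE sconn.
pose c1 := kempe_swap c a b A.
have c1P : edge_coloring c1 by exact: kempe_swap_coloring.
pose bad u := (u \in A) && (b \in missing c u).
have : exists p1, [/\ path (fan c x) y p1, uniq (y :: p1), bad (last y p1)
    & forall i, (i < size p1)%N -> ~~ bad (nth y (y :: p1) i)].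
  pose i := find bad (y :: p).
  have hasb : has bad (y :: p).
    by apply/hasP; exists z; rewrite ?zE ?mem_last // -zE /bad inE connect0.
  have ip : (i <= size p)%N by rewrite -ltnS -[(size p).+1]/(size (y :: p)) -has_find.
  have nthE j : (j <= i)%N -> nth y (y :: take i p) j = nth y (y :: p) j.
    by move=> ji; rewrite -[y :: take i p]/(take i.+1 (y :: p)) nth_take.
  exists (take i p); split.
  - by move: pp; rewrite -{1}(cat_take_drop i p) cat_path => /andP[].
  - by rewrite -[y :: take i p]/(take i.+1 (y :: p)) take_uniq.
  - by rewrite (last_nth y) size_takel // nthE // nth_find.
  - by move=> j; rewrite size_takel // => ji; rewrite nthE 1?ltnW // before_find.
case=> p1 [pp1 up1 /andP[lastA blast] notbad].
have [c' [c'P ext c'xy]] : exists c', [/\ edge_coloring c', extends c1 c' & c' x y].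
  apply: (@fan_rotate _ _ _ p1 a) => //.
  - by rewrite /c1 kempe_swap_out.
  - apply/(pathP y) => i ip; have /fanP[d xd du] := pathP y pp1 i ip.
    apply/fanP; exists d; first by rewrite /c1 kempe_swap_out.
    (* If [u] is on the chain, the swap must fix [d]: it is not [a], which is missing at [x], nor
       [b], which occurs at [u] because [u] is not bad. *)
    have da : d != a.
      by apply/eqP => da; have /missingP/(_ (nth y p1 i)) := ax; rewrite xd da.
    have := notbad i ip; rewrite /bad; set u := nth y (y :: p1) i in du *.
    have [uA|uA _] := boolP (u \in A); last by rewrite missing_kempe_swap_out.
    rewrite /= => nbu; have db : d != b by apply: contraNneq nbu => <-.
    by rewrite -(@tpermD _ a b d) 1?eq_sym // missing_kempe_swap_in.
  - by rewrite missing_kempe_swap_out.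
  - by rewrite -{1}(tpermR a b) missing_kempe_swap_in.
exists c'; split=> // u v uv; apply: ext; rewrite /c1 /kempe_swap.
by case: ifP => // _; case: (c u v) uv.
Qed.

Lemma extend_coloring c x y : edge_coloring c -> e x y -> c x y = None ->
  exists c', [/\ edge_coloring c', extends c c' & c' x y].
Proof.
move=> cP xy cxy.
pose Z := [set z | connect (fan c x) y z]%SET.
have hm u : exists a, a \in missing c u by exact: exists_missing.
pose m u := xchoose (hm u).
have mP u : m u \in missing c u := xchooseP (hm u).
have fanpath z : z \in Z -> exists2 p, path (fan c x) y p & uniq (y :: p) /\ z = last y p.
  by rewrite inE => /connectP[p0 /shortenP[p pp up _] zE]; exists p.
have [[z zZ mz]|nomx] := pselect (exists2 z, z \in Z & m z \in missing c x).
  have [p pp [up zE]] := fanpath z zZ.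
  by apply: (fan_rotate cP xy cxy pp up mz); rewrite -zE.
have hs z : z \in Z -> exists z', c x z' == Some (m z).
  move=> zZ; apply/existsP; apply: contra_notT nomx; rewrite negb_exists => /forallP nz.
  by exists z => //; rewrite inE; exact/forallP.
(* The colors missing on [Z] all occur on edges from [x] to [Z :\ y], and there
   are too few of these for [m] to be injective on [Z]. *)
have : ~~ [forall z1 in Z, forall z2 in Z, (m z1 == m z2) ==> (z1 == z2)].
  apply/negP => /forall_inP m_inj.
  pose g z := odflt x [pick z' | c x z' == Some (m z)].
  have gE z : z \in Z -> c x (g z) = Some (m z).
    by rewrite /g => /hs[z' xz']; case: pickP => [? /eqP//|/(_ z')]; rewrite xz'.
  have gZ : [set g z | z in Z]%SET \subset (Z :\ y)%SET.
    apply/fintype.subsetP => _ /imsetP[z zZ ->]; rewrite !inE; apply/andP; split.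
      by apply/eqP => gy; have := gE z zZ; rewrite gy cxy.
    have : y \in Z -> connect (fan c x) y z by move: zZ; rewrite inE.
    rewrite inE => /(_ (connect0 _ _)) yz; apply: connect_trans yz (connect1 _).
    by apply/fanP; exists (m z); rewrite ?gE.
  have := subset_leq_card gZ; rewrite card_in_imset; last first.
    move=> z1 z2 z1Z z2Z gg; apply/eqP.
    have /forall_inP/(_ z2 z2Z)/implyP := m_inj z1 z1Z; apply.
    by rewrite -(inj_eq Some_inj) -!gE // gg.
  by rewrite (cardsD1 y Z) inE connect0 ltnn.
rewrite negb_forall_in => /exists_inP[z1 z1Z]; rewrite negb_forall_in.
move=> /exists_inP[z2 z2Z]; rewrite negb_imply => /andP[/eqP mz12 z12].
have xZ z : z \in Z -> x != z.
  move=> zZ; suff: e x z by apply: contraTneq => ->; rewrite e_irr.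
  have [p + [_ ->]] := fanpath z zZ; case/lastP: p => [//|p w].
  rewrite rcons_path last_rcons => /andP[_ /fanP[d xw _]].
  by apply: (ec_edge cP); rewrite xw.
pose a := m x; pose b := m z1.
have [x1|x1] := boolP (connect (bicolored c a b) x z1); last first.
  have [p pp [up zE]] := fanpath z1 z1Z.
  exact: (extend_kempe cP xy cxy pp up zE (mP x) (mP z1) x1).
have [x2|x2] := boolP (connect (bicolored c a b) x z2); last first.
  have [p pp [up zE]] := fanpath z2 z2Z.
  by apply: (extend_kempe cP xy cxy pp up zE (mP x) _ x2); rewrite /b mz12.
(* [x] misses [a] while [z1] and [z2] miss [b], so all three would be endpoints of one chain. *)
case/eqP: z12; apply: (three_endpoints (bicolored_sym a b cP) _ _ _ _ x1 x2).
- by move=> u v1 v2 v3; apply: bicolored_deg2.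
- move=> t; rewrite !inE => /or3P[]/eqP->; apply: bicolored_endpoint => //.
  + by rewrite mP.
  + by rewrite mP orbT.
  + by rewrite /b mz12 mP orbT.
- exact: xZ.
- exact: xZ.
Qed.

(** Induction on the number of ordered pairs still to be colored; [extends] makes it drop. *)
Lemma exists_edge_coloring : exists2 c, edge_coloring c & forall u v, e u v -> c u v.
Proof.
pose todo c := [set uv : T * T | e uv.1 uv.2 && ~~ c uv.1 uv.2]%SET.
suff H n c : edge_coloring c -> (#|todo c| <= n)%N ->
    exists2 c', edge_coloring c' & forall u v, e u v -> c' u v.
  by apply: (H _ (fun _ _ => None)) (leqnn _); split.
elim: n c => [|n IH] c cP; (have [t0 _|[[x y]]] := set_0Vmem (todo c);
  first by exists c => // u v uv; have := finset.in_set0 (u, v);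
           rewrite -t0 inE uv => /negbFE).
  by move=> xyt; rewrite leqn0 cards_eq0 => /eqP t0; rewrite t0 inE in xyt.
rewrite inE /= => /andP[xy cxy] tn.
have cxyN : c x y = None by case: (c x y) cxy.
have [c' [c'P ext c'xy]] := extend_coloring cP xy cxyN.
apply: (IH c' c'P); rewrite -ltnS; apply: leq_trans tn; apply: proper_card.
apply/fintype.properP; split; last first.
  by exists (x, y); rewrite !inE /= xy ?cxy ?c'xy.
apply/fintype.subsetP => -[u v]; rewrite !inE /= => /andP[->].
by apply: contraNN => /ext.
Qed.

End EdgeColoring.

Theorem vizing (G : sgraph) : colorable (line_graph G) (max_degree G).+1.
Proof.
have deg_lt (u : G) : (#|[set v | adj u v]%SET| < #|'I_(max_degree G).+1|)%N.
  by rewrite card_ord ltnS degree_le.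
have [c cP cT] := exists_edge_coloring (@adj_sym G) (@adj_irrefl G) deg_lt.
have ends (f : line_graph G) : exists xy : G * G,
    adj xy.1 xy.2 && (val f == [set xy.1; xy.2]%SET).
  by have [x [y [xy _ ->]]] := edgeP f; exists (x, y); rewrite xy /=.
(* The default [ord0] never occurs, as [c] colors every edge; by symmetry of [c], the order in which
   [d f] lists the ends is immaterial. *)
pose d f := xchoose (ends f); pose k f := odflt ord0 (c (d f).1 (d f).2).
have kE f u v : val f = [set u; v]%SET -> c u v = Some (k f).
  rewrite /k /d; case/andP: (xchooseP (ends f)); set x := (_ _).1; set y := (_ _).2.
  move=> xy /eqP -> /setP xyuv; have := cT _ _ xy.
  have := xyuv x; have := xyuv y; rewrite !inE !eqxx orbT.
  have nxy : x != y by apply: contraTneq xy => ->; rewrite adj_irrefl.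
  move=> /esym/orP[]/eqP yE /esym/orP[]/eqP xE; rewrite ?xE ?yE ?eqxx // in nxy *;
  by rewrite ?(ec_sym cP v u); case: (c u v).
apply/existsP; exists [ffun f => k f]; apply/forallP => f; apply/forallP => g.
apply/implyP => /andP[fg /set0Pn[z]] /[!inE]/andP[zf zg]; rewrite !ffunE.
have other (h : line_graph G) : z \in val h -> exists w, val h = [set z; w]%SET.
  have [x [y [_ _ ->]]] := edgeP h.
  by rewrite !inE => /orP[]/eqP->; [exists y|exists x; rewrite finset.setUC].
have [v fE] := other f zf; have [w gE] := other g zg.
apply: contraNneq fg => kfg; apply/eqP/val_inj; rewrite fE gE.
by have := kE _ _ _ gE; rewrite -kfg => /(ec_inj cP (kE _ _ _ fE)) ->.
Qed.

(** * Contracting the matchings *)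

Lemma cliqueP (G : sgraph) (A : {set G}) :
  reflect {in A &, forall x y, x != y -> adj x y} (clique A).
Proof.
apply: (iffP forall_inP) => [H x y xA yA|H x xA].
  by have /forall_inP/(_ y yA)/implyP := H x xA.
by apply/forall_inP => y yA; apply/implyP; apply: H.
Qed.

Lemma stableP (G : sgraph) (A : {set G}) :
  reflect {in A &, forall x y, ~~ adj x y} (stable A).
Proof.
apply: (iffP forall_inP) => [H x y xA yA|H x xA].
  by have /forall_inP := H x xA; apply.
by apply/forall_inP => y yA; apply: H.
Qed.

Lemma clique_le (G : sgraph) (A : {set G}) : clique A -> (#|A| <= clique_number G)%N.
Proof. by move=> cA; apply: (@leq_bigmax_cond _ _ (fun A : {set G} => #|A|)). Qed.

Lemma chromatic_numberP (G : sgraph) : colorable G (chromatic_number G).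
Proof. by rewrite /chromatic_number; case: ex_minnP. Qed.

Lemma chromatic_number_le (G : sgraph) (K : finType) (c : G -> K) :
  (forall x y, adj x y -> c x != c y) -> (chromatic_number G <= #|K|)%N.
Proof.
move=> cP; rewrite /chromatic_number; case: ex_minnP => k _; apply.
apply/existsP; exists [ffun x => enum_rank (c x)].
apply/forallP => x; apply/forallP => y; apply/implyP => xy; rewrite !ffunE.
by rewrite (inj_eq enum_rank_inj) cP.
Qed.

Section FractionalChromaticNumber.
Variable R : realType.

(** Allows covers with any finite index type; the weights of indices giving the same stable set are
    added up. *)
Lemma fcn_le_family (G : sgraph) (I : finType) (P : pred I) (S : I -> {set G})
    (w : I -> R) :
  (forall i, P i -> 0 <= w i) -> (forall i, P i -> stable (S i)) ->
  (forall v, 1 <= \sum_(i | P i && (v \in S i)) w i) ->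
  fractional_chromatic_number R G <= \sum_(i | P i) w i.
Proof.
move=> w0 sS cov; apply: ge_inf; first by case: (fractional_chromatic_number_has_inf R G).
exists (fun A => \sum_(i | P i && (S i == A)) w i); last first.
  by rewrite (partition_big S (@stable G)).
split=> [A sA|v]; first by apply: sumr_ge0 => i /andP[/w0].
apply: le_trans (cov v) _.
rewrite (partition_big S (fun A => stable A && (v \in A))) /=; last first.
  by move=> i /andP[/sS -> ->].
apply: ler_sum => A /andP[_ vA]; rewrite le_eqVlt; apply/orP; left; apply/eqP.
apply: eq_bigl => i; rewrite -andbA; congr (_ && _).
by case: eqP => [->|]; rewrite ?vA // andbF.
Qed.

Lemma fcn_ge (G : sgraph) (m : R) :
  (forall w : {set G} -> R, fractional_coloring w -> m <= \sum_(S | stable S) w S) ->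
  m <= fractional_chromatic_number R G.
Proof.
move=> H; apply: lb_le_inf; first by case: (fractional_chromatic_number_has_inf R G).
by move=> _ [w wP <-]; apply: H.
Qed.

Lemma fcn_adherent (G : sgraph) (eps : R) : 0 < eps ->
  exists2 w : {set G} -> R, fractional_coloring w &
    \sum_(S | stable S) w S < fractional_chromatic_number R G + eps.
Proof.
move=> eps0.
have [_ [w wP <-] lt] := inf_adherent eps0 (fractional_chromatic_number_has_inf R G).
by exists w.
Qed.

End FractionalChromaticNumber.

(** * Subadditivity over a vertex partition *)

Section Decomposition.
Variables (G : sgraph) (n : nat) (k : G -> 'I_n.+1) (H : 'I_n.+1 -> sgraph).
Variable phi : forall i, G -> H i.
Hypothesis phi_hom : forall i x y,
  k x = i -> k y = i -> adj x y -> adj (phi i x) (phi i y).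

(** On the part of a clique in class [i], distinct vertices have adjacent, hence distinct, images
    under [phi i]. *)
Lemma clique_number_sum : (clique_number G <= \sum_i clique_number (H i))%N.
Proof.
apply/bigmax_leqP => A /cliqueP cA.
rewrite -sum1_card (partition_big k xpredT) //=; apply: leq_sum => i _.
rewrite sum1dep_card; set Ai := [set x | _]%SET.
have adjA : {in Ai &, forall x y, x != y -> adj (phi i x) (phi i y)}.
  move=> x y; rewrite !inE => /andP[xA /eqP xi] /andP[yA /eqP yi] xy.
  by apply: phi_hom => //; apply: cA.
rewrite -(@card_in_imset _ _ (phi i)); last first.
  move=> x y xA yA phixy; apply/eqP/negPn/negP => /(adjA _ _ xA yA).
  by rewrite phixy adj_irrefl.
apply/clique_le/cliqueP => _ _ /imsetP[x xA ->] /imsetP[y yA ->] xy.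
by apply: adjA => //; apply: contraNneq xy => ->.
Qed.

(** A color is tagged with its class, so that the palettes of different classes are disjoint. *)
Lemma chromatic_number_sum : (chromatic_number G <= \sum_i chromatic_number (H i))%N.
Proof.
have col i : exists c : H i -> 'I_(chromatic_number (H i)),
    forall x y, adj x y -> c x != c y.
  have /existsP[c cP] := chromatic_numberP (H i); exists c => x y.
  by have /forallP/(_ y)/implyP := forallP cP x.
pose c i := sval (cid (col i)).
have cP i : forall x y, adj x y -> c i x != c i y := svalP (cid (col i)).
pose K := {i : 'I_n.+1 & 'I_(chromatic_number (H i))}.
have -> : (\sum_i chromatic_number (H i) = #|{: K}|)%N.
  rewrite card_tagged sumnE big_map big_enum /=.
  by apply: eq_bigr => i _; rewrite card_ord.
apply: (@chromatic_number_le G K (fun x => Tagged _ (c (k x) (phi (k x) x)))) => x y xy.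
apply/eqP => E; have kxy : k x = k y by exact: (congr1 tag E).
rewrite kxy in E; have /eqP := eq_from_Tagged E; apply/negP.
by apply: cP; apply: phi_hom.
Qed.

Lemma fractional_chromatic_number_sum (R : realType) :
  fractional_chromatic_number R G <= \sum_i fractional_chromatic_number R (H i).
Proof.
apply/ler_addgt0Pr => eps eps0.
(* Near-optimal covers of the [H i] are used; the error [eps] is shared equally by the [n.+1]
   classes. *)
pose d := eps / n.+1%:R; have d0 : 0 < d by rewrite divr_gt0.
pose w i := sval (cid2 (fcn_adherent (H i) d0)).
have [wP wlt] : (forall i, fractional_coloring (w i)) /\
    (forall i, \sum_(S | stable S) w i S < fractional_chromatic_number R (H i) + d).
  by split=> i; rewrite /w; case: cid2.
have -> : eps = \sum_(i < n.+1) d.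
  by rewrite sumr_const card_ord -mulr_natr divfK.
rewrite -big_split /=; apply: le_trans (ler_sum _ (fun i _ => ltW (wlt i))).
rewrite sig_big_dep /=.
(* A stable set of [H i] is pulled back to class [i] and keeps its weight. *)
pose S (u : {i : 'I_n.+1 & {set H i}}) :=
  [set x | (k x == tag u) && (phi (tag u) x \in (tagged u : {set H (tag u)}))]%SET.
apply: (@fcn_le_family R G _ _ S (fun u => w (tag u) (tagged u))).
- by move=> [i A] /= sA; case: (wP i) => + _; apply.
- move=> [i A] /= /stableP sA; apply/stableP => x y; rewrite !inE /=.
  move=> /andP[/eqP xi xA] /andP[/eqP yi yA].
  by apply: contraNN (sA _ _ xA yA); apply: phi_hom.
- move=> v; have [_ /(_ (phi (k v) v))] := wP (k v); move/le_trans; apply.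
  rewrite (eq_bigl (fun u => (tag u == k v) &&
    (stable (tagged u) && (phi (tag u) v \in (tagged u : {set H (tag u)}))))); last first.
    by move=> [i A]; rewrite inE /= eq_sym; case: (i == k v); rewrite /= ?andbT ?andbF.
  rewrite -(sig_big_dep (fun i => i == k v)
    (fun i A => stable A && (phi i v \in A)) w) /=.
  by rewrite big_pred1_eq.
Qed.

End Decomposition.

(** * Contraction of the color classes *)

(** Induction on [s]: the edges are disjoint, so contracting some of them leaves the ends of the
    others distinct and adjacent, and the next one can still be contracted. *)
Lemma contract_matching (C : graph_class) (G : sgraph) (s : seq (edge_type G)) :
  contraction_closed C -> C G -> uniq s ->
  {in s &, forall f g, f != g -> val f :&: val g = finset.set0}%SET ->
  exists (H : sgraph) (q : G -> H), [/\ C H,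
    forall x y, q x = q y -> x = y \/ exists2 f, f \in s & (x \in val f) && (y \in val f),
    forall f, f \in s -> {in val f &, forall x y, q x = q y}
  & forall x y, adj x y -> q x = q y \/ adj (q x) (q y)].
Proof.
move=> CC CG; elim: s => [|f s IH] /=.
  move=> _ _; exists G, id; split=> //; first by left.
  by move=> x y; right.
move=> /andP[fs us] disj.
have {IH}[|H [q [CH q_inj q_const q_adj]]] := IH us.
  by move=> g h gs hs; apply: disj; rewrite inE ?gs ?hs orbT.
have q_injf t a : t \in val f -> q a = q t -> a = t.
  move=> tf /q_inj[//|[g gs /andP[ag tg]]].
  have fg : f != g by apply: contraNneq fs => ->.
  have := finset.in_set0 t; rewrite -(disj f g) ?inE ?eqxx ?gs ?orbT //.
  by rewrite tf tg.
have [x [y [xy _ fE]]] := edgeP f.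
have xf : x \in val f by rewrite fE !inE eqxx.
have yf : y \in val f by rewrite fE !inE eqxx orbT.
have nqxy : q x != q y.
  by apply: contraTneq xy => /(q_injf _ _ yf) ->; rewrite adj_irrefl.
have qxy : adj (q x) (q y).
  by have [E|//] := q_adj _ _ xy; rewrite E eqxx in nqxy.
(* The contraction removes [q y]; [q x] stands for the merged vertex. *)
pose r z := if z == q y then q x else z.
have r_neq z : r z != q y by rewrite /r; case: ifP => [_|->].
pose pi z : Defs.contract (q x) (q y) := exist (fun z => z != q y) (r z) (r_neq z).
exists (Defs.contract (q x) (q y)), (pi \o q); split.
- exact: CC.
- move=> a b /(congr1 val) /=; rewrite /r.
  case: eqP => [/(q_injf _ _ yf) ->|nay]; case: eqP => [/(q_injf _ _ yf) ->|nby].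
  + by left.
  + move=> /esym/(q_injf _ _ xf) ->; right; exists f; first by rewrite inE eqxx.
    by rewrite xf yf.
  + move=> /(q_injf _ _ xf) ->; right; exists f; first by rewrite inE eqxx.
    by rewrite xf yf.
  + move=> /q_inj[|[g gs abg]]; [by left|right].
    by exists g => //; rewrite inE gs orbT.
- move=> g; rewrite inE => /orP[/eqP-> a b|gs a b ag bg].
    rewrite fE !inE => /orP[]/eqP-> /orP[]/eqP->; apply/val_inj => //=;
    by rewrite /r eqxx (negPf nqxy).
  by rewrite /= (q_const g gs a b).
- move=> a b ab; have [E|nE] := eqVneq (pi (q a)) (pi (q b)); [by left|right].
  rewrite /= /contract_adj nE /= /r.
  have [E|qab] := q_adj a b ab; first by rewrite E eqxx in nE.
  case: eqP => [ay|nay]; case: eqP => [yb|nby].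
  + by rewrite ay yb adj_irrefl in qab.
  + by rewrite -ay qab eqxx orbT.
  + by rewrite -yb qab eqxx !orbT.
  + by rewrite qab.
Qed.

(** [H i] arises by contracting the [i]-th color class of [vizing], and [phi i] sends an edge of
    that class to the vertex it becomes. *)
Lemma contract_decomposition (C : graph_class) (G : sgraph) :
  contraction_closed C -> C G ->
  exists (k : line_square G -> 'I_(max_degree G).+1) (H : 'I_(max_degree G).+1 -> sgraph)
    (phi : forall i, line_square G -> H i),
  (forall i, C (H i)) /\
  forall i x y, k x = i -> k y = i -> adj x y -> adj (phi i x) (phi i y).
Proof.
move=> CC CG; have /existsP[k kP] := vizing G.
have k_neq (f g : edge_type G) : k f = k g -> f != g -> val f :&: val g = finset.set0.
  move=> kfg fg; apply/eqP; rewrite -[_ == _]negbK; apply/negP => fg0.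
  have fg_adj : @adj (line_graph G) f g by rewrite /adj /= /line_adj fg fg0.
  by have /forallP/(_ g) := forallP kP f; rewrite fg_adj kfg eqxx.
(* The dependent pair lets [choice] select the graph and the map together. *)
suff D i : exists Hphi : {H : sgraph & line_square G -> H}, C (tag Hphi) /\
    forall x y : line_square G, k x = i -> k y = i -> adj x y ->
      adj (tagged Hphi x) (tagged Hphi y).
  have [h hP] := choice D; exists k, (fun i => tag (h i)), (fun i => tagged (h i)).
  by split=> i; have [Ci homi] := hP i; [exact: Ci|exact: homi].
have [||H [q [CH q_inj q_const q_adj]]] :=
    @contract_matching C G (enum [pred f | k f == i]) CC CG.
- exact: enum_uniq.
- by move=> f g; rewrite !mem_enum !inE => /eqP fi /eqP gi; apply: k_neq; rewrite fi.
have pt (f : edge_type G) : exists x, x \in val f.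
  by have [x [y [_ _ ->]]] := edgeP f; exists x; rewrite !inE eqxx.
(* Which end is picked is immaterial: [q] merges the two ends of an edge of class [i]. *)
pose p f := xchoose (pt f).
have pP f : p f \in val f := xchooseP (pt f).
exists (existT _ H (q \o p)); split=> // f g fi gi.
have fs : f \in enum [pred f | k f == i] by rewrite mem_enum inE fi.
have gs : g \in enum [pred f | k f == i] by rewrite mem_enum inE gi.
have fg : k f = k g by rewrite fi gi.
rewrite line_square_adjE => /andP[nfg]; rewrite (k_neq f g) // eqxx /=.
case/exists_inP=> x xf /exists_inP[y yg xy].
rewrite (q_const f fs (p f) x) // (q_const g gs (p g) y) //.
(* If [q] merged [x] and [y], they would be the ends of a matching edge [h] meeting both [f] and
   [g], which forces [f = h = g]. *)
have [qxy|//] := q_adj x y xy.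
have [E|[h hs /andP[xh yh]]] := q_inj _ _ qxy; first by rewrite E adj_irrefl in xy.
have hi : k h = i by move: hs; rewrite mem_enum inE => /eqP.
have meet (f1 : edge_type G) z : k f1 = i -> z \in val f1 -> z \in val h -> f1 = h.
  move=> f1i zf1 zh; apply/eqP/negPn/negP => /k_neq E.
  by have := finset.in_set0 z; rewrite -E ?f1i ?hi // inE zf1 zh.
by case/eqP: nfg; rewrite (meet f x) // (meet g y).
Qed.

(** * Suprema over a class *)

Section ClassSup.
Variable R : realType.

Lemma class_sup_ge0 (P : sgraph -> Prop) (f : sgraph -> R) : (0 <= class_sup P f)%E.
Proof. by rewrite /class_sup le_max lexx. Qed.

Lemma class_sup_ge (P : sgraph -> Prop) (f : sgraph -> R) (G : sgraph) :
  P G -> ((f G)%:E <= class_sup P f)%E.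
Proof.
move=> PG; rewrite /class_sup le_max; apply/orP; right.
by apply: ereal_sup_ubound; exists G.
Qed.

Lemma class_sup_le_sum (P Q : sgraph -> Prop) (f g : sgraph -> R) (D : nat) :
  (forall G, P G -> exists H : 'I_D.+1 -> sgraph,
    (forall i, Q (H i)) /\ g G <= \sum_i f (H i)) ->
  (class_sup P g <= class_sup Q f * (D%:R + 1)%:E)%E.
Proof.
move=> dec; have := class_sup_ge0 Q f; have := @class_sup_ge Q f.
have D0 : 0 < D%:R + 1 :> R by rewrite natr1.
(* An infinite supremum stays infinite when multiplied by the positive [D + 1]. *)
case: (class_sup Q f) => [r| |] // ub r0; last by rewrite gt0_mulye ?lte_fin // leey.
rewrite -EFinM /class_sup ge_max; apply/andP; split.
  by rewrite lee_fin mulr_ge0 // ltW.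
apply: ge_ereal_sup => _ [G PG ->]; have [H [QH le]] := dec G PG.
rewrite lee_fin; apply: (le_trans le).
have -> : r * (D%:R + 1) = \sum_(i < D.+1) r.
  by rewrite natr1 sumr_const card_ord mulr_natr.
by apply: ler_sum => i _; rewrite -lee_fin ub.
Qed.

End ClassSup.

Lemma contraction_upper (R : realType) (C : graph_class) : contraction_closed C ->
  forall D : nat,
    [/\ (class_strong_omega R C D <= class_omega R C * (D%:R + 1)%:E)%E,
        (class_strong_chif R C D <= class_chif R C * (D%:R + 1)%:E)%E
      & (class_strong_chi R C D <= class_chi R C * (D%:R + 1)%:E)%E].
Proof.
move=> CC D; split; apply: class_sup_le_sum => G [CG <-];
  have [k [H [phi [CH hom]]]] := contract_decomposition CC CG; exists H; split=> //.
- by rewrite -natr_sum ler_nat; exact: clique_number_sum hom.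
- exact: fractional_chromatic_number_sum hom R.
- by rewrite -natr_sum ler_nat; exact: chromatic_number_sum hom.
Qed.

(** * Attaching pendant edges *)

Section StrongCliqueLowerBound.
Variables (G : sgraph) (K : {set G}).

Lemma degree_le_edges (x : G) :
  (#|[set y | adj x y]%SET| <= #|[set e : edge_type G | x \in val e]%SET|)%N.
Proof.
rewrite -(card_imset _ val_inj) -(@card_in_imset _ _ (fun y => [set x; y]%SET)).
  apply/subset_leq_card/fintype.subsetP => _ /imsetP[y + ->]; rewrite inE => xy.
  by apply/imsetP; exists (edge_of xy); rewrite ?inE /= ?inE ?eqxx.
move=> y z; rewrite !inE => xy xz /= /setP/(_ y); rewrite !inE eqxx orbT.
by move=> /esym/orP[]/eqP // yx; rewrite yx adj_irrefl in xy.
Qed.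

(** The binomial coefficient pays for the edges inside [K], which the degree sum counts twice;
    placed on the right, it avoids truncated subtraction. *)
Lemma strong_clique_number_ge : clique K ->
  (\sum_(x in K) #|[set y | adj x y]%SET| <= strong_clique_number G + 'C(#|K|, 2))%N.
Proof.
move=> /cliqueP cK.
pose A : {set line_square G} := [set e | val e :&: K != finset.set0]%SET.
have cA : clique A.
  apply/cliqueP => e f; rewrite !inE => /set0Pn[x] /[!inE]/andP[xe xK].
  move=> /set0Pn[y] /[!inE]/andP[yf yK] ef; rewrite line_square_adjE ef /=.
  have [xy|xy] := eqVneq x y.
    by apply/orP; left; apply/set0Pn; exists x; rewrite inE xe xy yf.
  apply/orP; right; apply/exists_inP; exists x => //.
  by apply/exists_inP; exists y => //; apply: cK.
(* Double counting: an edge meeting [K] is counted once, or twice if it lies in [K]. *)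
apply: (@leq_trans (\sum_(x in K) \sum_(e : edge_type G | x \in val e) 1)).
  by apply: leq_sum => x _; rewrite sum1dep_card degree_le_edges.
rewrite (exchange_big_dep xpredT) //=.
apply: (@leq_trans (\sum_(e : edge_type G) ((e \in A) + (val e \subset K)))).
  apply: leq_sum => e _; rewrite sum1dep_card.
  have -> : [set x in K | x \in val e]%SET = val e :&: K.
    by apply/setP => x; rewrite !inE andbC.
  rewrite inE; have [eK|neK] := boolP (val e \subset K).
    by rewrite (finset.setIidPl eK) card_edge -card_gt0 card_edge.
  rewrite -card_gt0; have : (#|val e :&: K| < 2)%N.
    rewrite -(card_edge e) proper_card // finset.properEneq finset.subsetIl andbT.
    by apply: contraNneq neK => <-; apply: finset.subsetIr.
  by case: #|_| => [|[|]].
rewrite big_split /= -!big_mkcond !sum1_card leq_add //; first exact: clique_le.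
rewrite -cards_draws -(card_imset _ val_inj).
apply/subset_leq_card/fintype.subsetP => _ /imsetP[e eK ->].
by rewrite inE card_edge eqxx andbT.
Qed.

End StrongCliqueLowerBound.

(* [H] is [G] with [d v] pendant edges attached at each [v]: [i] embeds [G], and
   [r] maps each new vertex to its neighbour, the new vertices being the [z]
   with [i (r z) != z]. *)
Record pendant_extension (G H : sgraph) (i : G -> H) (r : H -> G) (d : G -> nat) :
    Prop := PendantExtension {
  pe_cancel : cancel i r;
  pe_mono : {mono i : x y / adj x y};
  pe_adj : forall z t, i (r z) != z -> adj z t = (t == i (r z));
  pe_card : forall v, #|[set z | (i (r z) != z) && (r z == v)]%SET| = d v }.

Lemma card_set_option (T : finType) (P : pred (option T)) :
  #|[set z | P z]%SET| = (P None + #|[set x | P (Some x)]%SET|)%N.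
Proof.
have inj : injective (@Some T) by move=> x y [].
rewrite (cardsD1 None) inE -(card_imset _ inj); congr (_ + _)%N.
apply: eq_card => z; rewrite !inE; apply/andP/imsetP.
  by case: z => [x|] [//= _ Px]; exists x; rewrite ?inE.
by case=> x + ->; rewrite inE.
Qed.

(** Pendant edges are attached one at a time, following a list in which each [v] occurs [d v]
    times. *)
Lemma attach_pendants (C : graph_class) (G : sgraph) (d : G -> nat) :
  pendant_closed C -> C G ->
  exists (H : sgraph) (i : G -> H) (r : H -> G), C H /\ pendant_extension i r d.
Proof.
move=> CP CG.
suff main (s : seq G) : exists (H : sgraph) (i : G -> H) (r : H -> G),
    C H /\ pendant_extension i r (fun v => count_mem v s).
  have [H [i [r [CH [ri i_mono pend card]]]]] :=
    main (flatten [seq nseq (d v) v | v <- enum G]).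
  exists H, i, r; split=> //; split=> // v.
  rewrite card count_flatten -map_comp sumnE big_map big_enum /= (bigD1 v) //=.
  rewrite count_nseq /= eqxx mul1n big1 ?addn0 // => u uv.
  by rewrite count_nseq /= (negPf uv).
elim: s => [|v s [H [i [r [CH [ri i_mono pend card]]]]]].
  exists G, id, id; split=> //; split=> //= [z t|v]; rewrite ?eqxx //.
  by apply: eq_card0 => z; rewrite inE eqxx.
exists (attach_pendant (i v)), (fun x => Some (i x)),
  (fun z => if z is Some x then r x else v).
split; first exact: CP.
split=> //.
- move=> [z|] [t|] //=.
  + by rewrite !(inj_eq Some_inj); apply: pend.
  + by rewrite (inj_eq Some_inj) => /negPf nz; apply/eqP => zv; rewrite zv ri eqxx in nz.
- by move=> u; rewrite card_set_option /= card.
Qed.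

Section PendantDegrees.
Variables (G H : sgraph) (i : G -> H) (r : H -> G) (d : G -> nat).
Hypothesis HP : pendant_extension i r d.

(** The neighbours of [i v] are the images of those of [v] and the new vertices attached at [v], two
    disjoint sets. *)
Lemma pe_degree (v : G) :
  #|[set t | adj (i v) t]%SET| = (#|[set w | adj v w]%SET| + d v)%N.
Proof.
rewrite -(pe_card HP) -(card_imset _ (can_inj (pe_cancel HP))).
rewrite -[LHS]addn0 -cardsUI; congr (_ + _)%N.
  apply: eq_card => t; rewrite !inE; have [tE|nt] := boolP (i (r t) == t).
    rewrite orbF -(eqP tE) (pe_mono HP); apply/idP/imsetP.
      by move=> vt; exists (r t); rewrite // inE.
    by case=> w; rewrite inE => vw /(can_inj (pe_cancel HP)) ->.
  rewrite adj_sym (pe_adj HP) // (inj_eq (can_inj (pe_cancel HP))) eq_sym /=.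
  rewrite [X in _ = X || _](_ : _ = false) //; apply/imsetP => -[w _ tw].
  by rewrite tw (pe_cancel HP) eqxx in nt.
apply: esym; apply: eq_card0 => t; rewrite !inE; apply/negP => /and3P[/imsetP[w _ ->]].
by rewrite (pe_cancel HP) eqxx.
Qed.

(** The new vertices have degree one, whence [0 < D]. *)
Lemma pe_max_degree (D : nat) (v : G) : (0 < D)%N ->
  (forall u, #|[set w | adj u w]%SET| + d u <= D)%N ->
  (#|[set w | adj v w]%SET| + d v)%N = D -> max_degree H = D.
Proof.
move=> D0 le vD; apply/eqP; rewrite eqn_leq; apply/andP; split.
  apply/bigmax_leqP => z _; have [/eqP <-|nz] := boolP (i (r z) == z).
    by rewrite pe_degree.
  apply: leq_trans D0; rewrite -(cards1 (i (r z))) subset_leq_card //.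
  by apply/fintype.subsetP => t; rewrite !inE (pe_adj HP).
rewrite -[X in (X <= _)%N]vD -pe_degree.
exact: (@leq_bigmax _ (fun z : H => #|[set t | adj z t]%SET|)).
Qed.

End PendantDegrees.

(** * The two lower bounds *)

Lemma degree_lt_card (G : sgraph) (v : G) : (#|[set w | adj v w]%SET| < #|G|)%N.
Proof.
rewrite -cardsT proper_card // finset.properEneq finset.subsetT andbT.
by apply/eqP => /setP/(_ v); rewrite !inE adj_irrefl.
Qed.

Lemma clique_number_attained (G : sgraph) :
  exists2 A : {set G}, clique A & #|A| = clique_number G.
Proof.
have c0 : clique (finset.set0 : {set G}) by apply/cliqueP => x y; rewrite inE.
rewrite /clique_number (bigop.bigmax_eq_arg finset.set0 c0); case: arg_maxnP => // A cA _.
by exists A.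
Qed.

Lemma strong_omega_lower (R : realType) (C : graph_class) (D w : nat) :
  pendant_closed C -> class_omega R C = (w%:R)%:E -> (w < D)%N -> omega_attained R C D ->
  ((w%:R * D%:R - 'C(w, 2)%:R)%:E <= class_strong_omega R C D)%E.
Proof.
move=> CP wE wD [G [CG]]; rewrite wE => -[/eqP]; rewrite eqr_nat => /eqP {wE}wG GD.
(* For [w = 0] the bound is 0; otherwise the clique has a vertex [v] at which degree [D] will be
   attained. *)
have [w0|w_gt0] := posnP w.
  by rewrite w0 mul0r subr0 class_sup_ge0.
have [K cK cardK] := clique_number_attained G; rewrite -wG in cardK.
have [v vK] : exists v, v \in K by apply/card_gt0P; rewrite cardK.
(* Clique vertices are filled up to degree [D]; nothing is truncated, because [omega_attained]
   bounds the degrees of [G] by [D]. *)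
pose d u := (if u \in K then D - #|[set t | adj u t]%SET| else 0)%N.
have [H [i [r [CH HP]]]] := attach_pendants d CP CG.
have degD (u : G) : (#|[set t | adj u t]%SET| <= D)%N := leq_trans (degree_le u) GD.
have HD : max_degree H = D.
  apply: (pe_max_degree (v := v) HP); first exact: leq_trans wD.
    by move=> u; rewrite /d; case: ifP; rewrite ?addn0 ?subnKC.
  by rewrite /d vK subnKC.
apply: le_trans (class_sup_ge _ (conj CH HD)).
rewrite lee_fin lerBlDr -natrM -natrD ler_nat.
have i_inj := can_inj (pe_cancel HP).
have cHK : clique [set i x | x in K]%SET.
  apply/cliqueP => _ _ /imsetP[x xK ->] /imsetP[y yK ->]; rewrite (inj_eq i_inj) => xy.
  by rewrite (pe_mono HP); move/cliqueP: cK; apply.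
have := strong_clique_number_ge cHK; rewrite card_imset // cardK; apply: leq_trans.
rewrite big_imset /=; last by move=> x y _ _ /i_inj.
rewrite (eq_bigr (fun=> D)); first by rewrite sum_nat_const cardK.
by move=> u uK; rewrite (pe_degree HP) /d uK subnKC.
Qed.

(* [p] embeds a blow-up of [G], each vertex being replaced by a clique of order at
   least [k], in [L]; a stable set of [L] meets each of these cliques at most once. *)
Lemma fcn_blowup (R : realType) (G L : sgraph) (Z : finType) (p : Z -> L) (r : Z -> G)
    (k : nat) :
  (forall y z, y != z -> (r y == r z) || adj (r y) (r z) -> adj (p y) (p z)) ->
  (forall v, (k <= #|[set z | r z == v]%SET|)%N) -> (0 < k)%N ->
  fractional_chromatic_number R G * k%:R <= fractional_chromatic_number R L.
Proof.
move=> p_adj k_le k0; have kR : 0 < k%:R :> R by rewrite ltr0n.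
apply: fcn_ge => w [w0 cov]; rewrite -ler_pdivlMr // mulr_suml.
(* Stable sets of [L] are projected to [G] with weights divided by [k]. The at least [k] elements of
   [Z] over [v] each collect weight at least 1, and no stable set serves two of them. *)
apply: (@fcn_le_family R G _ _ (fun S : {set L} => [set r z | z in Z & p z \in S]%SET)).
- by move=> S /w0 wS; rewrite divr_ge0 // ltW.
- move=> S /stableP sS; apply/stableP => _ _ /imsetP[y yS ->] /imsetP[z zS ->].
  rewrite !inE /= in yS zS; apply: contra (sS _ _ yS zS) => ryz.
  apply: p_adj; last by rewrite ryz orbT.
  by apply: contraTneq ryz => ->; rewrite adj_irrefl.
- move=> v; rewrite -mulr_suml ler_pdivlMr // mul1r.
  apply: (@le_trans _ _ (\sum_(z | r z == v) \sum_(S | stable S && (p z \in S)) w S)).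
    apply: (@le_trans _ _ (\sum_(z | r z == v) 1)); last exact: ler_sum.
    by rewrite sumr_const ler_nat; have := k_le v; rewrite cardsE.
  rewrite (exchange_big_dep (fun S : {set L} => stable S
    && (v \in [set r z | z in Z & p z \in S]%SET))) /=; last first.
    by move=> z S /eqP <- /andP[-> pz]; rewrite imset_f // inE.
  apply: ler_sum => S /andP[sS _]; rewrite sumr_const -mulr_natr.
  apply: ler_piMr; first exact: w0.
  rewrite lern1; apply/card_le1_eqP => y z.
  move=> /andP[/eqP ry /andP[_ yS]] /andP[/eqP rz /andP[_ zS]].
  apply/eqP/negPn/negP => yz; have /stableP/(_ _ _ yS zS)/negP := sS; apply.
  by apply: p_adj; [rewrite eq_sym|rewrite ry rz eqxx].
Qed.

Lemma strong_chif_lower (R : realType) (C : graph_class) (D : nat) (G : sgraph) :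
  pendant_closed C -> C G -> (#|G| < D)%N ->
  ((fractional_chromatic_number R G * (D%:R - #|G|%:R + 1))%:E
     <= class_strong_chif R C D)%E.
Proof.
move=> CP CG GD.
have -> : D%:R - #|G|%:R + 1 = (D - #|G|).+1%:R :> R by rewrite -natr1 natrB 1?ltnW.
(* The graph without vertices cannot be brought to degree [D]; the empty family covers it, so its
   fractional chromatic number is at most 0. *)
have [G0|/card_gt0P[v _]] := posnP #|G|.
  apply: le_trans (class_sup_ge0 _ _); rewrite lee_fin mulr_le0_ge0 //.
  rewrite -[leRHS](@big_pred0_eq R 0 +%R {set G} (index_enum _) (fun=> 0)).
  by apply: (@fcn_le_family R G {set G} pred0 id) => // v; have /card0_eq/(_ v) := G0.
pose d (u : G) := (D - #|[set t | adj u t]%SET|)%N.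
have [H [i [r [CH HP]]]] := attach_pendants d CP CG.
have degD (u : G) : (#|[set t | adj u t]%SET| <= D)%N.
  exact: ltnW (ltn_trans (degree_lt_card u) GD).
have HD : max_degree H = D.
  apply: (pe_max_degree (v := v) HP); first exact: leq_trans GD.
    by move=> u; rewrite /d subnKC.
  by rewrite /d subnKC.
apply: le_trans (class_sup_ge _ (conj CH HD)); rewrite lee_fin.
(* Pendant edges are indexed by their new ends. *)
pose Z : finType := {z : H | i (r z) != z}.
have pE (z : Z) : adj (val z) (i (r (val z))).
  by rewrite (pe_adj HP) ?eqxx // (valP z).
pose p z : line_square H := edge_of (pE z).
have notpend (z : Z) x : val z != i x.
  by apply: contraNneq (valP z) => ->; rewrite (pe_cancel HP).
have p_inj : injective p.
  move=> y z /(congr1 val)/setP/(_ (val y)); rewrite !inE eqxx /=.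
  by rewrite (negPf (notpend y _)) orbF => /esym/eqP/val_inj.
apply: (@fcn_blowup R G _ Z p (fun z => r (val z))) => //.
- move=> y z yz; rewrite line_square_adjE (inj_eq p_inj) yz /=.
  case/orP=> [/eqP ryz|ryz]; apply/orP; [left|right].
    by apply/set0Pn; exists (i (r (val y))); rewrite !inE ryz eqxx !orbT.
  apply/exists_inP; exists (i (r (val y))); first by rewrite !inE eqxx orbT.
  apply/exists_inP; exists (i (r (val z))); first by rewrite !inE eqxx orbT.
  by rewrite (pe_mono HP).
- move=> u; apply: (@leq_trans (d u)).
    (* Degrees in [G] are at most [|G| - 1], which gives the [+ 1] of the bound. *)
    by apply: ltn_sub2l (degree_lt_card u); apply: ltn_trans (degree_lt_card u) GD.
  rewrite -(pe_card HP) -(card_imset _ val_inj) subset_leq_card //.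
  apply/fintype.subsetP => z; rewrite inE => /andP[pz rz].
  by apply/imsetP; exists (exist _ z pz); rewrite ?inE.
Qed.

Theorem theorem2p1 (R : realType) (C : graph_class) :
  (contraction_closed C -> forall D : nat,
    [/\ (class_strong_omega R C D <= class_omega R C * (D%:R + 1)%:E)%E,
        (class_strong_chif R C D <= class_chif R C * (D%:R + 1)%:E)%E
      & (class_strong_chi R C D <= class_chi R C * (D%:R + 1)%:E)%E])
  /\
  (pendant_closed C -> forall D : nat,
    (forall w : nat,
        class_omega R C = (w%:R)%:E ->
        (w < D)%N ->
        omega_attained R C D ->
        ((w%:R * D%:R - 'C(w, 2)%:R)%:E <= class_strong_omega R C D)%E)
    /\
    (forall G : sgraph, C G -> (#|G| < D)%N ->
        ((fractional_chromatic_number R G * (D%:R - #|G|%:R + 1))%:E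
           <= class_strong_chif R C D)%E)).
Proof.
split=> [CC D|CP D]; first exact: contraction_upper.
split=> [w|G]; [exact: strong_omega_lower|exact: strong_chif_lower].
Qed.
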